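(* For every odd integer $k>1$ and every $m\in\mathbb{Z}$, the series $$\sum_{n=-\infty}^{+\infty}\frac{1}{\left(n+m+\frac12\right)^k}$$ is null (i.e. its sum equals $0$), hence an algebraic number.
   Context: The bilateral series is over all $n\in\mathbb{Z}$ and converges absolutely. *)

(* Defs.v *)
From HB Require Import structures.
From mathcomp Require Export all_boot all_order all_algebra.
From mathcomp Require Export all_classical all_reals all_analysis.
From mathcomp.analysis Require showcase.summability.
Export numFieldNormedType.Exports.

Set Implicit Arguments.
Unset Strict Implicit.
Unset Printing Implicit Defensive.
Import Order.TTheory GRing.Theory Num.Theory.
Local Open Scope classical_set_scope.
Local Open Scope ring_scope.

(* Bilateral series are summed unconditionally: the filter [totally] directs
   the sums over finite sets of integers by inclusion of these sets. For an
   absolutely convergent series this agrees with every ordering of the terms,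
   and with the limit of the sums over -M <= n <= N as M and N tend to
   infinity independently. *)
Definition bilateral_cvg (R : realType) (u : int -> R) : Prop :=
  cvg (summability.partial_sum u @ summability.totally).

Definition bilateral_sum (R : realType) (u : int -> R) : R :=
  summability.sum u.

Definition bilateral_abs_cvg (R : realType) (u : int -> R) : Prop :=
  summable [set: int] (EFin \o u).

(* Main.v *)
Require Import Defs.
From mathcomp Require Import finmap ring lra zify.
Import Order.TTheory GRing.Theory Num.Theory.
Local Open Scope classical_set_scope.
Local Open Scope ring_scope.

(** The reflection n |-> -n - 2m - 1 of the integers sends n + m + 1/2 to its
    opposite, so for odd k it negates the terms of the series.

    Absolute convergence turns this antisymmetry into a statement on
    unconditional sums: some finite set A carries all of the absolute sum up to
    e; once A is completed by its mirror image, the terms over it cancel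
    exactly, and a larger finite set only adds terms of total absolute value
    below e. Hence the partial sums tend to 0
    ([partial_sum_odd_involution_cvg0]).

    Absolute convergence itself ([summable_half_integer_powV]) is translation
    invariant, which disposes of m, and the remaining absolute series is twice
    the sum of (p + 1/2)^-k over the naturals, which a telescoping series
    dominates as soon as k is at least 2. *)

Lemma sum_odd_involution_eq0 {R : numDomainType} {I : choiceType} {u : I -> R}
    {s : I -> I} {A : {fset I}} :
  involutive s -> (forall i, u (s i) = - u i) ->
  (forall i, i \in A -> s i \in A) -> \sum_(i <- A) u i = 0.
Proof.
move=> sK u_odd sA; have /eqP : \sum_(i <- A) u i = - \sum_(i <- A) u i.
  have perm_sA : perm_eq A (map s A).
    apply: uniq_perm; rewrite ?(map_inj_uniq (inv_inj sK)) ?fset_uniq// => i.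
    apply/idP/mapP => [iA|[j jA ->]]; last exact: sA.
    by exists (s i); [exact: sA|rewrite sK].
  rewrite {1}(perm_big _ perm_sA)/= big_map -sumrN.
  by apply: eq_bigr => i _; rewrite u_odd.
by rewrite -subr_eq0 opprK -mulr2n mulrn_eq0/= => /eqP.
Qed.

(** If A carries more than S - e of the absolute sum S, then a finite set B
    disjoint from A carries less than e, since A and B together carry at most
    S. *)
Lemma summable_tail_lt {R : realType} {I : choiceType} {u : I -> R} {e : R} :
  summable [set: I] (EFin \o u) -> 0 < e ->
  exists A : {fset I}, forall B : {fset I}, [disjoint A & B]%fset ->
    \sum_(i <- B) `|u i| < e.
Proof.
rewrite summableE => Sfin e0; set S := esum _ _ in Sfin.
have sumE (A : {fset I}) :
    (\sum_(i \in [set` A]) `|(EFin \o u) i|)%E = (\sum_(i <- A) `|u i|)%:E.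
  by rewrite fsbig_finite//= set_fsetK -sumEFin.
have ltS : (S - e%:E < S)%E by rewrite lteBlDr// lteDl.
have [_ [X [finX _] <-] ltX] := ereal_sup_gt ltS.
exists (fset_set X) => B AB.
have : ((\sum_(i <- (fset_set X `|` B)%fset) `|u i|)%:E <= S)%E.
  rewrite -sumE; apply: ereal_sup_ubound; exists [set` (fset_set X `|` B)%fset] => //.
have -> : \sum_(i <- (fset_set X `|` B)%fset) `|u i|
        = \sum_(i <- fset_set X) `|u i| + \sum_(i <- B) `|u i|.
  rewrite -big_cat/=; apply/perm_big/uniq_perm.
  - exact: fset_uniq.
  - rewrite cat_uniq !fset_uniq/= andbT; apply/hasPn => i iB.
    by apply: contraTN iB => iX; exact: (fdisjointP AB).
  - by move=> i; rewrite mem_cat inE.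
move: ltX; rewrite -(fset_setK finX) sumE set_fsetK -(fineK Sfin).
rewrite -EFinB lte_fin lee_fin; lra.
Qed.

(** Antisymmetry forces a null sum only together with absolute convergence,
    which makes the terms outside a finite symmetric set negligible. *)
Lemma partial_sum_odd_involution_cvg0 {R : realType} {I : choiceType}
    {u : I -> R} {s : I -> I} :
  involutive s -> (forall i, u (s i) = - u i) ->
  summable [set: I] (EFin \o u) ->
  summability.partial_sum u @ summability.totally --> (0 : R).
Proof.
move=> sK u_odd usum; have FT := @summability.totally_filter I.
apply/cvgrPdist_lt => e e0.
have [A tailA] := summable_tail_lt usum e0.
pose A' := (A `|` [fset s i | i in A])%fset.
have sA' i : i \in A' -> s i \in A'.
  rewrite !inE => /orP[iA|/imfsetP[j /= jA ->]]; last by rewrite sK jA.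
  by rewrite in_imfset ?orbT.
have subAA' : (A `<=` A')%fset by exact: fsubsetUl.
clearbody A'; exists A' => // B /= A'B.
rewrite sub0r normrN /summability.partial_sum.
rewrite -(big_seq_fsetE _ _ predT u)/= (big_fsetID _ (mem A'))/=.
have -> : [fset x | x in B & x \in A']%fset = A'.
  apply/fsetP => i; rewrite !inE/=.
  by apply/andP/idP => [[]//|iA']; split=> //; exact: (fsubsetP A'B).
rewrite (sum_odd_involution_eq0 sK u_odd sA') add0r.
apply: le_lt_trans (ler_norm_sum _ _ _) _; apply: tailA.
by apply/fdisjointP => i iA; rewrite !inE/= (fsubsetP subAA' _ iA) andbF.
Qed.

(** The right-hand side is 2 ^+ k.+1 / ((p + 1) * (p + 2)): it telescopes, and
    the crude constant absorbs both the powers beyond the square, each base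
    being at least 1/2, and the bound
    (p + 1) * (p + 2) <= 8 * (p + 1/2) ^+ 2. *)
Lemma half_integer_powV_le (R : realType) (k p : nat) : (1 < k)%N ->
  ((p%:R + 1 / 2) ^+ k)^-1 <= 2 ^+ k.+1 * (p.+1%:R^-1 - p.+2%:R^-1) :> R.
Proof.
case: k => [|[|j]]// _; rewrite -(natr1 p.+1) -(natr1 p).
have : 0 <= p%:R :> R by [].
move: p%:R => x x0.
have -> : (x + 1)^-1 - (x + 1 + 1)^-1 = ((x + 1) * (x + 2))^-1.
  by field; lra.
have -> : 2 ^+ j.+3 * ((x + 1) * (x + 2))^-1
        = ((1 / 2) ^+ j * ((x + 1) * (x + 2) / 8))^-1 :> R.
  rewrite mul1r exprVn !exprS; field.
  by rewrite expf_neq0//; lra.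
rewrite lef_pV2 ?posrE ?exprn_gt0 ?mulr_gt0 ?exprn_gt0 ?invr_gt0//; try lra.
rewrite -[X in _ <= _ ^+ X]addn2 exprD.
apply: ler_pM; rewrite ?exprn_ge0//; try nra.
by apply: lerXn2r; rewrite ?nnegrE; lra.
Qed.

Lemma half_integer_sum_lt_pinfty (R : realType) (k : nat) : (1 < k)%N ->
  (\esum_(p in [set: nat]) ((p%:R + 1 / 2 : R) ^+ k)^-1%:E < +oo)%E.
Proof.
move=> k1; have half_ge0 (p : nat) : 0 <= (p%:R + 1 / 2 : R).
  by apply: addr_ge0; [exact: ler0n|lra].
rewrite -nneseries_esumT => [|p]; last by rewrite lee_fin invr_ge0 exprn_ge0.
apply: (@le_lt_trans _ _ (2 ^+ k.+1)%:E); last exact: ltry.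
apply: lime_le => [|].
  by apply: is_cvg_nneseries => p _ _; rewrite lee_fin invr_ge0 exprn_ge0.
apply: nearW => n; rewrite sumEFin lee_fin.
apply: (@le_trans _ _
    (\sum_(0 <= p < n) 2 ^+ k.+1 * (p.+1%:R^-1 - p.+2%:R^-1))).
  by apply: ler_sum => p _; exact: half_integer_powV_le.
rewrite -mulr_sumr ler_piMr ?exprn_ge0//.
under eq_bigr do rewrite -opprB.
rewrite sumrN (telescope_sumr (fun p => p.+1%:R^-1 : R))//.
by rewrite opprB invr1 gerBl invr_ge0.
Qed.

Lemma summable_half_integer_powV (R : realType) (k : nat) (m : int) :
  (1 < k)%N ->
  summable [set: int] (EFin \o (fun n => 1 / (n%:~R + m%:~R + 1 / 2) ^+ k : R)).
Proof.
move=> k1; rewrite /summable.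
pose a (n : int) : \bar R := `|((n%:~R + 1 / 2 : R) ^+ k)^-1|%:E.
have a_ge0 n : (0 <= a n)%E by rewrite lee_fin.
rewrite [X in (X < _)%E](_ : _ = \esum_(n in [set: int]) a n); last first.
  rewrite [RHS](reindex_esum [set: int] _ (+%R^~ m))//.
    by apply: eq_esum => n _; rewrite /a/= rmorphD/= mul1r.
  split=> // [n n' _ _ /addIr//|n _]; by exists (n - m); rewrite //= subrK.
have half_ge0 (p : nat) : 0 <= (p%:R + 1 / 2 : R).
  by apply: addr_ge0; [exact: ler0n|lra].
(* As Negz p is - (p + 1), adding 1/2 gives - (p + 1/2): both halves of the
   integers contribute the same sum. *)
rewrite (esumID (range Posz)) ?setTI//.
have -> : ~` range Posz = range Negz.
  apply/seteqP; split=> -[] n //=.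
  - by move=> []; exists n.
  - by exists n.
  - by move=> [].
  - by move=> _ [].
have E1 : (\esum_(n in range Posz) a n =
    \esum_(p in [set: nat]) ((p%:R + 1 / 2 : R) ^+ k)^-1%:E)%E.
  rewrite esum_image; last by move=> p q _ _ [].
  by apply: eq_esum => p _; rewrite /a/= ger0_norm// invr_ge0 exprn_ge0.
have E2 : (\esum_(n in range Negz) a n =
    \esum_(p in [set: nat]) ((p%:R + 1 / 2 : R) ^+ k)^-1%:E)%E.
  rewrite esum_image; last by move=> p q _ _ [].
  apply: eq_esum => p _; rewrite /a/=.
  have -> : (Negz p)%:~R + 1 / 2 = - (p%:R + 1 / 2) :> R.
    by rewrite NegzE rmorphN/= -natr1; field.
  by rewrite normfV normrX normrN ger0_norm.
by rewrite E1 E2 lte_add_pinfty// half_integer_sum_lt_pinfty.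
Qed.

Theorem lemma5 (R : realType) (k : nat) (m : int) :
  odd k -> (1 < k)%N ->
  let u := fun n : int => 1 / (n%:~R + m%:~R + 1 / 2) ^+ k : R in
  [/\ bilateral_abs_cvg u, bilateral_cvg u, bilateral_sum u = 0
    & algebraicOver (ratr : rat -> R) (bilateral_sum u)].
Proof.
move=> k_odd k1 u.
have u_sum : bilateral_abs_cvg u by exact: summable_half_integer_powV.
pose s (n : int) : int := - n - m - m - 1.
have sK : involutive s by move=> n; rewrite /s; lia.
have u_odd n : u (s n) = - u n.
  rewrite /u; have -> : (s n)%:~R + m%:~R + 1 / 2
      = - (n%:~R + m%:~R + 1 / 2) :> R.
    by rewrite /s !rmorphB/= rmorphN/=; field.
  by rewrite exprNn -signr_odd k_odd expr1 mulN1r invrN mulrN.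
have u_cvg0 := partial_sum_odd_involution_cvg0 sK u_odd u_sum.
have FT := @summability.totally_filter int.
have sum0 : bilateral_sum u = 0 by exact: cvg_lim u_cvg0.
split=> //; first by apply/cvg_ex; exists 0.
by rewrite sum0; exact: algebraic0.
Qed.
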